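(* Let $K$ be a field, let $G$ be a finite simple graph with vertex set $V(G)=\{x_1,\ldots,x_n\}$ and with at least one edge, and let $R=K[x_1,\ldots,x_n]$. Then $\mathrm{v}(J(G))\leq \mathrm{reg}(R/J(G))$. In other words, $\mathrm{v}(J(G))\leq \mathrm{pd}(R/I(G))-1$.
   Context: $R=K[x_1,\ldots,x_n]=\bigoplus_{d\ge 0}R_d$ has the standard grading; the vertices of $G$ are identified with the variables of $R$. The edge ideal of $G$ is $I(G)=\langle x_ix_j : \{x_i,x_j\}\in E(G)\rangle\subseteq R$. A vertex cover of $G$ is a set $C\subseteq V(G)$ meeting every edge; it is minimal if it is minimal under inclusion. For $C\subseteq V(G)$ put $X_C=\prod_{x_i\in C}x_i$. The cover ideal of $G$ is $J(G)=\langle X_C : C \text{ a minimal vertex cover of } G\rangle=\bigcap_{\{x_i,x_j\}\in E(G)}\langle x_i,x_j\rangle$. For a proper graded ideal $I\subseteq R$, the $\mathrm{v}$-number is $\mathrm{v}(I)=\min\{d\ge 0 : \text{there exist } f\in R_d \text{ and } \mathfrak p\in \mathrm{Ass}(I) \text{ with } I:f=\mathfrak p\}$, where $\mathrm{Ass}(I)$ is the set of associated primes of $I$ (i.e. of $R/I$). $\mathrm{reg}(R/I)=\max\{j-i : \beta_{i,j}(R/I)\ne 0\}$ is the Castelnuovo-Mumford regularity and $\mathrm{pd}(R/I)=\max\{i : \beta_{i,j}(R/I)\neq 0 \text{ for some } j\}$ is the projective dimension, where $\beta_{i,j}(R/I)$ are the graded Betti numbers of $R/I$ over $R$. *)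

(* Defs.v *)
From HB Require Import structures.
From mathcomp Require Import all_boot all_order all_algebra.
From mathcomp Require Import mpoly.

Set Implicit Arguments.
Unset Strict Implicit.
Unset Printing Implicit Defensive.

Import Order.TTheory GRing.Theory Num.Theory.
Local Open Scope ring_scope.

Section Ideals.

Variables (n : nat) (K : fieldType).
Local Notation R := {mpoly K[n]}.

(* Membership in an ideal of R is not given by a boolean test, so subsets of R
   are Prop-valued predicates and equality of ideals is pointwise <->. *)
Definition rset := R -> Prop.

Definition same_rset (I J : rset) : Prop := forall f, I f <-> J f.

Definition is_ideal (I : rset) : Prop :=
  [/\ I 0, forall f g, I f -> I g -> I (f + g) & forall f g, I g -> I (f * g)].

Definition ideal_gen (S : rset) : rset := fun f =>
  exists s : seq (R * R),
    (forall c, c \in s -> S c.2) /\ f = \sum_(c <- s) c.1 * c.2.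

Definition colon (I : rset) (f : R) : rset := fun g => I (g * f).

Definition is_prime_ideal (p : rset) : Prop :=
  [/\ is_ideal p, ~ p 1 & forall f g, p (f * g) -> p f \/ p g].

(* The annihilator in R of the class of h in R/I is I : h. *)
Definition associated_prime (I p : rset) : Prop :=
  is_prime_ideal p /\ exists h : R, same_rset (colon I h) p.

(* In mpoly, 0 is d.-homog for every d, so d.-homog is membership in R_d. *)
Definition v_degree (I : rset) (d : nat) : Prop :=
  exists (f : R) (p : rset),
    [/\ f \is d.-homog, associated_prime I p & same_rset (colon I f) p].

Definition is_vnumber (I : rset) (v : nat) : Prop :=
  v_degree I v /\ forall d, v_degree I d -> (v <= d)%N.

(* A minimal graded free resolution
     ... -> F_2 -> F_1 -> F_0 -> R/I -> 0,   F_i = (+)_a R(- mfr_deg i a).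
   Elements of F_i are row vectors and mfr_diff i : F_(i+1) -> F_i acts by
   right multiplication. The augmentation F_0 -> R/I sends the a-th basis
   element to the class of mfr_aug a 0. Shifts may be taken in nat because R/I
   lives in nonnegative degrees. *)
Record min_free_res (I : rset) := MinFreeRes {
  mfr_rank : nat -> nat;
  mfr_deg : forall i, 'I_(mfr_rank i) -> nat;
  mfr_diff : forall i, 'M[R]_(mfr_rank i.+1, mfr_rank i);
  mfr_aug : 'cV[R]_(mfr_rank 0);
  mfr_diff_homog : forall i a b, mfr_diff i a b != 0 ->
    (mfr_deg b <= mfr_deg a)%N /\
    mfr_diff i a b \is (mfr_deg a - mfr_deg b).-homog;
  mfr_aug_homog : forall a, mfr_aug a 0 \is (mfr_deg a).-homog;
  mfr_aug_surj : forall f : R, exists u : 'rV[R]_(mfr_rank 0),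
    I (f - (u *m mfr_aug) 0 0);
  mfr_exact0 : forall u : 'rV[R]_(mfr_rank 0),
    I ((u *m mfr_aug) 0 0) <-> exists w, u = w *m mfr_diff 0;
  mfr_exactS : forall i (u : 'rV[R]_(mfr_rank i.+1)),
    u *m mfr_diff i = 0 <-> exists w, u = w *m mfr_diff i.+1;
  (* minimality: the entries lie in (x_1, ..., x_n) *)
  mfr_minimal : forall i a b, (mfr_diff i a b)@_0%MM = 0
}.

Definition graded_betti (I : rset) (F : min_free_res I) (i j : nat) : nat :=
  #|[set a : 'I_(mfr_rank F i) | mfr_deg a == j]|.

(* The graded Betti numbers do not depend on the minimal resolution F. *)
Definition is_reg (I : rset) (r : int) : Prop :=
  exists F : min_free_res I,
    (exists i j, graded_betti F i j <> 0%N /\ r = j%:Z - i%:Z) /\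
    (forall i j, graded_betti F i j <> 0%N -> j%:Z - i%:Z <= r).

Definition is_pd (I : rset) (p : nat) : Prop :=
  exists F : min_free_res I,
    (exists j, graded_betti F p j <> 0%N) /\
    (forall i j, graded_betti F i j <> 0%N -> (i <= p)%N).

Variable e : rel 'I_n.

Definition edge_ideal : rset :=
  ideal_gen (fun f => exists i j, e i j /\ f = 'X_i * 'X_j).

Definition vertex_cover (C : {set 'I_n}) : bool :=
  [forall i, forall j, e i j ==> (i \in C) || (j \in C)].

Definition cover_ideal : rset :=
  ideal_gen (fun f => exists C : {set 'I_n},
    minset vertex_cover C /\ f = \prod_(i in C) 'X_i).

End Ideals.

Arguments edge_ideal {n} K e _ : rename.
Arguments cover_ideal {n} K e _ : rename.

(* Main.v *)
Require Import Defs.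
From HB Require Import structures.
From mathcomp Require Import all_boot all_order all_algebra.
From mathcomp Require Import mpoly.
From mathcomp Require Import ring zify.
From Stdlib Require Import Classical_Prop.

Set Implicit Arguments.
Unset Strict Implicit.
Unset Printing Implicit Defensive.

Import Order.TTheory GRing.Theory Num.Theory.
Local Open Scope ring_scope.

(* Let A be maximal among the independent sets such that the graph induced
   on W = V \ N[A] still has an edge p1 p2; then non-adjacency is transitive on
   W, i.e. W is complete multipartite.  Put U = V \ A and D = U \ {p1, p2}.

   - D covers every edge except p1 p2, so J : X_D = (x_p1, x_p2) and
     v(J) <= |D| = |U| - 2.
   - The link of A in the independence complex is disconnected (its components
     are the parts of W).  This yields a nonzero Koszul class
     in H_2(x_1, ..., x_n; R/J) of degree |U|, namely X_D e_p1 e_p2, hence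
     reg(R/J) >= |U| - 2, and a nonzero class in H_(|U|-1)(x_U; R/I), namely
     X_A times the part of d(e_U) that involves only the variables of the part
     of p1, hence pd(R/I) >= |U| - 1.

   A Koszul class is compared with a resolution F by the usual zigzag through
   the double complex Koszul (x) F. *)

(** The terms at (u, v) and (v, u) cancel. The diagonal is a separate hypothesis because in
    characteristic 2 antisymmetry does not force it to vanish. *)
Lemma sum_antisym (n : nat) (V : zmodType) (f : 'I_n -> 'I_n -> V) :
  (forall u v, f u v = - f v u) -> (forall u, f u u = 0) ->
  \sum_u \sum_v f u v = 0.
Proof.
move=> fN f0.
have split_lt u : \sum_v f u v =
    \sum_(v : 'I_n | (v < u)%N) f u v - \sum_(v : 'I_n | (u < v)%N) f v u.
  rewrite (bigID (fun v : 'I_n => (v < u)%N)) /=; congr (_ + _).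
  rewrite (bigD1 u) ?ltnn //= f0 add0r -sumrN.
  apply: eq_big => [v|v _]; last exact: fN.
  by rewrite -leqNgt ltn_neqAle eq_sym andbC.
rewrite (eq_bigr _ (fun u _ => split_lt u)) sumrB.
rewrite (exchange_big_dep predT) //= -sumrB big1 // => u _.
by rewrite subrr.
Qed.

(** * Monomial ideals *)

Section MonomialIdeals.

Variables (n : nat) (K : fieldType).
Local Notation R := {mpoly K[n]}.
Implicit Types (f g h : R) (m : 'X_{1..n}) (S : pred 'X_{1..n}).

(** For up-closed [S] this is the monomial ideal spanned by the monomials in [S]; membership becomes
    a condition on coefficients. *)
Definition msupp_in S : rset n K := fun f => {in msupp f, forall m, S m}.

Definition up_closed S := forall m m', S m -> S (m + m')%MM.

Lemma msupp_inP S f : msupp_in S f <-> (forall m, ~~ S m -> f@_m = 0).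
Proof.
split=> [Sf m nSm | Sf m]; first by apply/memN_msupp_eq0/negP=> /Sf; exact/negP.
by rewrite mcoeff_msupp; apply: contraNT=> /Sf ->.
Qed.

Lemma msupp_in_ideal S : up_closed S -> is_ideal (msupp_in S).
Proof.
move=> upS; split=> [|f g|f g Sg].
- by apply/msupp_inP=> m _; rewrite mcoeff0.
- move=> /msupp_inP Sf /msupp_inP Sg; apply/msupp_inP=> m nSm.
  by rewrite mcoeffD Sf // Sg // addr0.
move=> m /msuppM_le /allpairsP [[m1 m2] /= [_ /Sg Sm2 ->]].
by rewrite addmC; apply: upS.
Qed.

Lemma msupp_in_pihomog S d f : msupp_in S f -> msupp_in S (pihomog mdeg d f).
Proof.
move=> /msupp_inP Sf; apply/msupp_inP=> m nSm; rewrite pihomogE raddf_sum /=.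
rewrite big1 // => m' _; rewrite mcoeffZ mcoeffX.
by case: eqP => [->|_]; rewrite ?mulr0 // Sf ?mul0r.
Qed.

Lemma msupp_inX S m : msupp_in S 'X_[m] <-> S m.
Proof.
split=> [|Sm m']; first by apply; rewrite msuppX mem_seq1.
by rewrite msuppX mem_seq1 => /eqP ->.
Qed.

Lemma ideal_sum (I : rset n K) (J : finType) (P : pred J) (F : J -> R) :
  is_ideal I -> (forall j, P j -> I (F j)) -> I (\sum_(j | P j) F j).
Proof. by case=> I0 ID _ IF; apply: (big_ind I) => //. Qed.

Lemma is_ideal_same (I J : rset n K) : same_rset I J -> is_ideal J -> is_ideal I.
Proof.
move=> IJ [J0 JD JM]; split=> [|f g /IJ If /IJ Ig|f g /IJ Ig]; apply/IJ => //.
  exact: JD.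
exact: JM.
Qed.

Lemma idealN (I : rset n K) f : is_ideal I -> I f -> I (- f).
Proof. by case=> _ _ IM If; rewrite -mulN1r; apply: IM. Qed.

Lemma idealB (I : rset n K) f g : is_ideal I -> I f -> I g -> I (f - g).
Proof. by move=> idI If Ig; have [_ ID _] := idI; apply: ID => //; apply: idealN. Qed.

(** Every monomial in the support of f is a multiple of a generator, so f is decomposed term by term
    along its support. *)
Lemma ideal_gen_msupp (Gen : rset n K) S :
  up_closed S ->
  (forall h, Gen h -> exists2 m, h = 'X_[m] & S m) ->
  (forall m, S m -> exists m1 m2, Gen 'X_[m1] /\ m = (m1 + m2)%MM) ->
  same_rset (ideal_gen Gen) (msupp_in S).
Proof.
move=> upS GenS SGen f; have [S0 SD SM] := msupp_in_ideal upS; split.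
  case=> s [sGen ->]; rewrite big_seq; apply: (big_ind (msupp_in S)) => // c /sGen.
  by case/GenS=> m -> Sm; apply/SM/msupp_inX.
move=> Sf; rewrite [f]mpolyE.
have: {subset msupp f <= msupp f} by [].
elim: {-2}(msupp f) => [|m s IHs] sub_s.
  by exists [::]; rewrite !big_nil.
rewrite big_cons; have [m1 [m2 [Gm1 Em]]] := SGen m (Sf _ (sub_s _ (mem_head _ _))).
case: IHs => [m' m's|t [tGen ->]]; first by apply: sub_s; rewrite inE m's orbT.
exists ((f@_m *: 'X_[m2], 'X_[m1]) :: t); split=> [c|].
  by rewrite inE => /orP[/eqP -> //|/tGen].
by rewrite big_cons /= -scalerAl -mpolyXD [(m2 + _)%MM]addmC -Em.
Qed.

End MonomialIdeals.

(** * The Koszul complex *)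

Section Koszul.

Variables (n : nat) (K : fieldType).
Local Notation R := {mpoly K[n]}.
Implicit Types (U T P : {set 'I_n}) (u v : 'I_n).

(** The sign of moving e_u past the smaller indices of T in the exterior product of e_u and e_T. *)
Definition ksign u T : R := (-1) ^+ #|[set t in T | (t < u)%N]|.

(* The differential of K(x_u : u in U) (x) V, the chain z having component z T
   along e_T; the indices of T outside U are inert. *)
Definition koszul_d (V : lmodType R) U (z : {set 'I_n} -> V) T : V :=
  \sum_(u in U :\: T) (ksign u T * 'X_u) *: z (u |: T).

Lemma ksignK u T : ksign u T * ksign u T = 1.
Proof. by rewrite -expr2 sqrr_sign. Qed.

Lemma ksignU u v T : u \notin T ->
  ksign v (u |: T) = (-1) ^+ (u < v)%N * ksign v T.
Proof.
move=> uT; rewrite /ksign -exprD; congr (_ ^+ _).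
case: ltnP => uv.
  rewrite (_ : [set _ in _ | _] = u |: [set t in T | (t < v)%N]).
    by rewrite cardsU1 inE (negPf uT).
  by apply/setP=> t; rewrite !inE andb_orl; case: eqP => [->|//]; rewrite uv.
rewrite (_ : [set _ in _ | _] = [set t in T | (t < v)%N]) //.
by apply/setP=> t; rewrite !inE; case: eqP => [->|//]; rewrite ltnNge uv !andbF.
Qed.

Lemma ksign_anti u v T : u != v -> u \notin T -> v \notin T ->
  ksign u T * ksign v (u |: T) = - (ksign v T * ksign u (v |: T)).
Proof.
move=> uv uT vT; rewrite !ksignU //.
case: (ltngtP u v) => [_|_|/val_inj E]; last by rewrite E eqxx in uv.
  by rewrite expr0 expr1; ring.
by rewrite expr0 expr1; ring.
Qed.

Section Linear.

Variables (V V' : lmodType R).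
Implicit Types (z : {set 'I_n} -> V).

Lemma eq_koszul_d U z z' T :
  (forall u, u \in U :\: T -> z (u |: T) = z' (u |: T)) -> koszul_d U z T = koszul_d U z' T.
Proof. by move=> zz'; apply: eq_bigr => u uUT; rewrite zz'. Qed.

Lemma koszul_d_linear U (f : {linear V -> V'}) z T :
  koszul_d U (fun T => f (z T)) T = f (koszul_d U z T).
Proof. by rewrite linear_sum; apply: eq_bigr => u _; rewrite linearZ. Qed.

Lemma koszul_dD U z z' T : koszul_d U (fun T => z T + z' T) T = koszul_d U z T + koszul_d U z' T.
Proof. by rewrite -big_split; apply: eq_bigr => u _; rewrite scalerDr. Qed.

Lemma koszul_dZ U (a : R) z T : koszul_d U (fun T => a *: z T) T = a *: koszul_d U z T.
Proof.
rewrite scaler_sumr; apply: eq_bigr => u _.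
by rewrite !scalerA mulrC.
Qed.

Lemma koszul_dB U z z' T : koszul_d U (fun T => z T - z' T) T = koszul_d U z T - koszul_d U z' T.
Proof. by rewrite -sumrB; apply: eq_bigr => u _; rewrite scalerBr. Qed.

Lemma koszul_dU1 u U z T : u \notin U ->
  koszul_d (u |: U) z T =
    koszul_d U z T + (if u \in T then 0 else (ksign u T * 'X_u) *: z (u |: T)).
Proof.
move=> uU; rewrite /koszul_d; case: ifPn => uT.
  rewrite addr0; apply: eq_bigl => v; rewrite !inE.
  by case: eqP => [->|//]; rewrite uT (negPf uU).
rewrite (bigD1 u) /=; last by rewrite !inE eqxx uT.
rewrite addrC; congr (_ + _); apply: eq_bigl => v; rewrite !inE.
by case: eqP => [->|]; rewrite ?andbF ?(negPf uU) ?andbT ?andbF.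
Qed.

Lemma koszul_d_setD U P z T : P \subset U ->
  koszul_d U z T = koszul_d P z T + koszul_d (U :\: P) z T.
Proof.
move=> sPU; rewrite /koszul_d (bigID (mem P)) /=; congr (_ + _); apply: eq_bigl => u.
  by rewrite !inE; case: (boolP (u \in P)) => [/(subsetP sPU) ->|]; rewrite ?andbF ?andbT.
by rewrite !inE; case: (u \in P); rewrite ?andbF ?andbT.
Qed.

Lemma koszul_d_sq U z T : koszul_d U (koszul_d U z) T = 0.
Proof.
(* The summand of the double sum, extended by zero to all pairs; exchanging u and v flips its sign
   by [ksign_anti]. *)
pose g u v : V := if [&& u \in U :\: T, v \in U :\: T & u != v] then
   (ksign u T * ksign v (u |: T) * ('X_u * 'X_v)) *: z (u |: (v |: T)) else 0.
rewrite -(@sum_antisym _ _ g); first last.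
- by move=> u; rewrite /g eqxx !andbF.
- move=> u v; rewrite /g (eq_sym v u) andbCA.
  case: ifP => [/and3P[]|_]; last by rewrite oppr0.
  rewrite !inE => /andP[vT _] /andP[uT _] uv.
  by rewrite ksign_anti // mulNr scaleNr setUCA ['X_u * _]mulrC.
rewrite [LHS]big_mkcond; apply: eq_bigr => u _; case: ifPn => uUT; last first.
  by rewrite big1 // => v _; rewrite /g (negPf uUT).
rewrite /koszul_d scaler_sumr big_mkcond; apply: eq_bigr => v _.
rewrite /g uUT /=; rewrite !inE (eq_sym v u) negb_or -!andbA andbCA (andbC (u != v)).
case: ifP => // _; rewrite scalerA setUCA; congr (_ *: _).
by rewrite mulrACA.
Qed.

End Linear.

Lemma koszul_d_mulmx U p r s (z : {set 'I_n} -> 'M[R]_(p, r)) (M : 'M[R]_(r, s)) T :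
  koszul_d U (fun T => z T *m M) T = koszul_d U z T *m M.
Proof. exact: (koszul_d_linear U (mulmxr M) z T). Qed.

End Koszul.

(** * Exactness of the Koszul complex of a set of variables on free modules *)

Section KoszulExact.

Variables (n : nat) (K : fieldType).
Local Notation R := {mpoly K[n]}.
Implicit Types (U T P : {set 'I_n}) (u v : 'I_n).

Definition in_varsM (V : lmodType R) U (y : V) :=
  exists c : 'I_n -> V, y = \sum_(v in U) 'X_v *: c v.

Section InVars.

Variable V : lmodType R.
Implicit Types (y : V) (z : {set 'I_n} -> V).

Lemma in_varsMD U y y' : in_varsM U y -> in_varsM U y' -> in_varsM U (y + y').
Proof.
move=> [c ->] [c' ->]; exists (fun v => c v + c' v).
by rewrite -big_split; apply: eq_bigr => v _; rewrite scalerDr.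
Qed.

Lemma in_varsMZ U a y : in_varsM U y -> in_varsM U (a *: y).
Proof.
move=> [c ->]; exists (fun v => a *: c v).
by rewrite scaler_sumr; apply: eq_bigr => v _; rewrite !scalerA mulrC.
Qed.

Lemma in_varsMB U y y' : in_varsM U y -> in_varsM U y' -> in_varsM U (y - y').
Proof.
by move=> Uy Uy'; rewrite -scaleN1r; apply: in_varsMD => //; apply: in_varsMZ.
Qed.

Lemma in_varsM0 U : in_varsM U (0 : V).
Proof. by exists (fun _ => 0); rewrite big1 // => v _; rewrite scaler0. Qed.

Lemma in_varsM_koszul_d U z T : in_varsM U (koszul_d U z T).
Proof.
exists (fun u => if u \in T then 0 else ksign K u T *: z (u |: T)).
rewrite /koszul_d big_mkcond [RHS]big_mkcond; apply: eq_bigr => u _; rewrite !inE.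
by case: (u \in T); case: (u \in U); rewrite ?scaler0 //= scalerA mulrC.
Qed.

End InVars.

(** (x_U) is a monomial ideal: each term of f can be divided by some variable of U occurring in
    it. *)
Lemma in_varsM_msupp U (f : R) :
  in_varsM U (f : R^o) <->
  msupp_in (fun m => [exists v in U, m v != 0%N]) f.
Proof.
set S := fun m : 'X_{1..n} => _.
have upS : up_closed S.
  move=> m m' /exists_inP[v vU mv]; apply/exists_inP; exists v => //.
  by rewrite mnmDE addn_eq0 negb_and mv.
split.
  case=> c ->; apply: ideal_sum (msupp_in_ideal _ upS) _ => v vU.
  have [_ _ SM] := msupp_in_ideal K upS.
  rewrite -[_ *: _]/('X_v * c v) mulrC; apply/SM/msupp_inX.
  by apply/exists_inP; exists v; rewrite // mnm1E eqxx.
move=> Sf; rewrite [f]mpolyE.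
have: {subset msupp f <= msupp f} by [].
elim: {-2}(msupp f) => [|m s IHs] sub_s.
  by rewrite big_nil; apply: in_varsM0.
rewrite big_cons.
have /exists_inP[v vU mv] := Sf m (sub_s _ (mem_head _ _)).
apply: (@in_varsMD R^o).
  exists (fun v' => if v' == v then f@_m *: 'X_[m - U_(v)] else 0).
  rewrite (bigD1 v) //= eqxx big1 => [|v' /andP[_ /negPf->]]; last exact: scaler0.
  rewrite addr0 -[RHS]/('X_v * (f@_m *: 'X_[m - U_(v)])) -scalerAr -mpolyXD.
  by rewrite addmC submK // lep1mP.
by apply: IHs => m' m's; apply: sub_s; rewrite inE m's orbT.
Qed.

Lemma in_varsM_row U r (y : 'rV[R]_r) :
  (forall b, in_varsM U (y 0 b : R^o)) -> in_varsM U y.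
Proof.
move=> Uy; have [d Ed] := fin_all_exists Uy; exists (fun v => \row_b d b v).
by apply/rowP=> b; rewrite Ed summxE; apply: eq_bigr => v _; rewrite !mxE.
Qed.

(** x_u is a nonzerodivisor modulo (x_U), since multiplying by it leaves the exponents at U
    unchanged. This is the regular-sequence property behind [koszul_exact]. *)
Lemma in_varsM_divX U u r (y : 'rV[R]_r) : u \notin U ->
  in_varsM U ('X_u *: y) -> in_varsM U y.
Proof.
move=> uU [c Ey]; apply: in_varsM_row => b.
have: in_varsM U ('X_u * y 0 b : R^o).
  exists (fun v => c v 0 b); move/rowP/(_ b): Ey; rewrite !mxE => ->.
  by rewrite summxE; apply: eq_bigr => v _; rewrite mxE.
move=> /in_varsM_msupp/msupp_inP Sy; apply/in_varsM_msupp/msupp_inP => m.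
move=> nSm; rewrite -(mcoeffMX _ U_(u)) mulrC; apply: Sy.
rewrite negb_exists_in; apply/forall_inP=> v vU; rewrite mnmDE mnm1E.
case: (u =P v) => [uv|_]; first by rewrite uv vU in uU.
by move: nSm; rewrite negb_exists_in => /forall_inP/(_ v vU).
Qed.

(* Induction on U: K(x_u, x_U) is the cone of x_u on K(x_U).  The chain w1'
   cancels the components along e_u, the chain w3 moves the remaining ones from
   (x_u, x_U) into (x_U). *)
Lemma koszul_exact U r (z : {set 'I_n} -> 'rV[R]_r) :
    (forall T, koszul_d U z T = 0) ->
    (forall T, [disjoint T & U] -> in_varsM U (z T)) ->
  exists w, forall T, z T = koszul_d U w T.
Proof.
elim: {U}_.+1 {-2}U (ltnSn #|U|) z => // k IHk U ltUk z dz zU.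
have [U0|[u uU]] := set_0Vmem U.
  exists z => T; rewrite dz; have: [disjoint T & U] by rewrite U0 disjoints_subset setC0 subsetT.
  by move/zU=> [c ->]; rewrite big_pred0 // => v; rewrite U0 inE.
pose U' := U :\ u; have uU' : u \notin U' by rewrite !inE eqxx.
have EU : U = u |: U' by rewrite setD1K.
have {}IHk := IHk U'.
have {}IHk : forall z : {set 'I_n} -> 'rV[R]_r, (forall T, koszul_d U' z T = 0) ->
    (forall T, [disjoint T & U'] -> in_varsM U' (z T)) ->
    exists w, forall T, z T = koszul_d U' w T.
  by apply: IHk; rewrite (cardsD1 u) uU in ltUk.
rewrite EU in dz zU *; clear EU ltUk uU; clearbody U'; clear U.
rename U' into U, uU' into uU, IHk into IH.
have memV v T : v \in U -> (u \in v |: T) = (u \in T).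
  by rewrite !inE => vU; case: eqP => // uv; rewrite uv vU in uU.
have kd_restr (b : bool) w T : koszul_d U (fun T => if (u \in T) == b then w T else 0) T =
    if (u \in T) == b then koszul_d U w T else 0 :> 'rV[R]_r.
  case: ifPn => Tb.
    by apply: eq_koszul_d => v; rewrite inE => /andP[_ vU]; rewrite memV // Tb.
  rewrite /koszul_d big1 // => v; rewrite inE => /andP[_ vU].
  by rewrite memV // (negPf Tb) scaler0.
have kd_off w T : u \in T -> koszul_d (u |: U) w T = koszul_d U w T :> 'rV[R]_r.
  by move=> uT; rewrite koszul_dU1 // uT addr0.
have kd_on w T : u \notin T ->
    koszul_d (u |: U) w T = koszul_d U w T + (ksign K u T * 'X_u) *: w (u |: T) :> 'rV[R]_r.
  by move=> uT; rewrite koszul_dU1 // (negPf uT).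
have kdPB w w' T : (forall T, koszul_d (u |: U) w T = 0) ->
    koszul_d (u |: U) (fun T => w T - koszul_d (u |: U) w' T) T = 0 :> 'rV[R]_r.
  by move=> dw; rewrite koszul_dB dw koszul_d_sq subr0.
(* The components along e_u form a cycle for U. In Koszul degree 0, evaluating dz = 0 at [T :\ u]
   puts x_u z T in (x_U), and x_u can be divided out. *)
have [T|T dTU|w1 Ew1] := IH (fun T => if (u \in T) == true then z T else 0).
- by rewrite kd_restr; case: eqP => // uT; rewrite -kd_off.
- case: eqP => [uT|_]; last exact: in_varsM0.
  apply: in_varsM_divX uU _.
  have := dz (T :\ u); rewrite kd_on ?inE ?eqxx // setD1K // -scalerA.
  move/eqP; rewrite addrC addr_eq0 => /eqP E.
  rewrite -[_ *: _]scale1r -(ksignK _ u (T :\ u)) -scalerA E -scaleN1r.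
  by do 2!apply: in_varsMZ; apply: in_varsM_koszul_d.
pose w1' T := if (u \in T) == true then w1 T else 0.
pose z2 T := z T - koszul_d (u |: U) w1' T.
have dz2 T : koszul_d (u |: U) z2 T = 0 by apply: kdPB.
have z2u T : u \in T -> z2 T = 0.
  by move=> uT; rewrite /z2 kd_off // kd_restr uT -Ew1 uT subrr.
(* On the components of Koszul degree 0, [g] collects the multiple of x_u and leaves a remainder in
   (x_U). *)
have [g Eg] : exists g, forall T, [disjoint T & u |: U] ->
    in_varsM U (z2 T - 'X_u *: g T).
  apply: (fin_all_exists (P := fun T g => _ -> in_varsM U (z2 T - 'X_u *: g))) => T.
  case: (boolP [disjoint T & u |: U]) => [dT|_]; last by exists 0.
  have [c Ec] : in_varsM (u |: U) (z2 T).
    by apply: in_varsMB; [apply: zU | apply: in_varsM_koszul_d].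
  exists (c u) => _; exists c; rewrite Ec (bigD1 u) ?setU11 //= addrC addrK.
  apply: eq_bigl => v; rewrite !inE; case: eqP => [->|]; rewrite ?andbT //.
  by rewrite (negPf uU).
pose w3 (S : {set 'I_n}) : 'rV[R]_r := if (u \in S) && [disjoint S :\ u & U]
  then ksign K u (S :\ u) *: g (S :\ u) else 0.
pose z3 T := z2 T - koszul_d (u |: U) w3 T.
have dz3 T : koszul_d (u |: U) z3 T = 0 by apply: kdPB.
have z3u T : u \in T -> z3 T = 0.
  move=> uT; rewrite /z3 kd_off // z2u // sub0r /koszul_d big1 ?oppr0 // => v.
  rewrite inE => /andP[vT vU]; rewrite /w3 ifF ?scaler0 //.
  apply/negP=> /andP[_ /disjoint_setI0/setP/(_ v)]; rewrite !inE eqxx vU andbT /=.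
  by case: eqP => // vu; rewrite -vu vU in uU.
have [T|T dTU|w4 Ew4] := IH z3.
- case: (boolP (u \in T)) => uT; first by rewrite -kd_off.
  by have := dz3 T; rewrite kd_on // z3u ?setU11 // scaler0 addr0.
- case: (boolP (u \in T)) => uT; first by rewrite z3u //; apply: in_varsM0.
  have dT : [disjoint T & u |: U].
    by rewrite -setI_eq0 setIUr setU_eq0 !setI_eq0 dTU andbT disjoint_sym disjoints1.
  have ET : (u |: T) :\ u = T by rewrite setU1K.
  rewrite /z3 kd_on // {2}/w3 setU11 ET dTU /= scalerA mulrAC ksignK mul1r.
  rewrite opprD addrA addrAC; apply: in_varsMB; last exact: in_varsM_koszul_d.
  exact: Eg.
pose w4' T := if (u \in T) == false then w4 T else 0.
exists (fun T => w1' T + w3 T + w4' T) => T.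
rewrite !koszul_dD; have -> : koszul_d (u |: U) w4' T = z3 T.
  case: (boolP (u \in T)) => uT; first by rewrite kd_off // kd_restr uT z3u.
  by rewrite kd_on // kd_restr (negPf uT) /w4' setU11 scaler0 addr0 Ew4.
by rewrite addrC [koszul_d _ w1' _ + _]addrC addrA /z3 /z2 !subrK.
Qed.

End KoszulExact.

(** * Koszul homology and graded resolutions *)

Section GradedParts.

Variables (n : nat) (K : fieldType).
Local Notation R := {mpoly K[n]}.

(** Checked on the monomials of f: multiplication by g raises each degree by exactly e, so nothing
    lands in degree d when e > d. *)
Lemma pihomogM d e (f g : R) : g \is e.-homog ->
  pihomog mdeg d (f * g) =
    if (e <= d)%N then pihomog mdeg (d - e) f * g else 0.
Proof.
move=> hg; have hXg m : 'X_[m] * g \is (mdeg m + e).-homog.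
  by apply: dhomogM hg; rewrite dhomogX eqxx.
rewrite [f]mpolyE mulr_suml !linear_sum /=; have [led|ltd] := leqP; last first.
  rewrite big1 // => m _; rewrite -scalerAl linearZ /=.
  by rewrite (pihomog_ne0 _ (hXg m)) ?scaler0 // gtn_eqF // ltn_addl.
rewrite mulr_suml; apply: eq_bigr => m _.
rewrite -scalerAl !linearZ /= -scalerAl; congr (_ *: _).
rewrite pihomogX; case: eqP => [Em|/eqP nEm].
  by apply: pihomog_dE; move: (hXg m); rewrite Em subnK.
rewrite mul0r; apply: pihomog_ne0 (hXg m); apply: contra nEm => /eqP <-.
by rewrite addnK.
Qed.

(* The component of degree d in the graded module (+)_a R(- deg a). *)
Definition hpart r (deg : 'I_r -> nat) d (y : 'rV[R]_r) : 'rV[R]_r :=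
  \row_a if (deg a <= d)%N then pihomog mdeg (d - deg a) (y 0 a) else 0.

Section HPart.

Variables (r : nat) (deg : 'I_r -> nat).
Implicit Types (y : 'rV[R]_r).

Lemma hpart0 d : hpart deg d 0 = 0.
Proof. by apply/rowP=> a; rewrite !mxE linear0 if_same. Qed.

Lemma hpart_sum (J : finType) (P : pred J) d (F : J -> 'rV[R]_r) :
  hpart deg d (\sum_(j | P j) F j) = \sum_(j | P j) hpart deg d (F j).
Proof.
apply/rowP=> a; rewrite !mxE !summxE linear_sum /=.
case: ifP => dega; first by apply: eq_bigr => j _; rewrite mxE dega.
by rewrite big1 // => j _; rewrite mxE dega.
Qed.

Lemma hpart_id d y : hpart deg d (hpart deg d y) = hpart deg d y.
Proof.
by apply/rowP=> a; rewrite !mxE; case: (deg a <= d)%N; rewrite // pihomog_id.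
Qed.

Lemma hpartZ d y (a : R) : a \is 1.-homog ->
  hpart deg d.+1 (a *: y) = a *: hpart deg d y.
Proof.
move=> ha; apply/rowP=> b; rewrite !mxE mulrC (pihomogM _ _ ha) subn_gt0 ltnS.
case: (ltngtP (deg b) d.+1) => [|lt|->].
- by rewrite ltnS => le; rewrite le subnAC subn1 mulrC.
- by rewrite leqNgt ltnW ?mulr0.
by rewrite ltnn mulr0.
Qed.

Lemma hpart_koszul_d U d (z : {set 'I_n} -> 'rV[R]_r) T :
  (forall T, hpart deg d (z T) = z T) ->
  hpart deg d.+1 (koszul_d U z T) = koszul_d U z T.
Proof.
move=> hz; rewrite hpart_sum; apply: eq_bigr => u _.
rewrite hpartZ ?hz // /ksign -signr_odd; case: odd; rewrite ?mulN1r ?mul1r.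
  by rewrite rpredN dhomogX /= mdeg1.
by rewrite dhomogX /= mdeg1.
Qed.

(** With these shifts M is a graded map of degree 0, so it commutes with taking components. *)
Lemma hpart_mulmx s (deg' : 'I_s -> nat) (M : 'M[R]_(r, s)) d y :
  (forall a b, M a b != 0 ->
    (deg' b <= deg a)%N /\ M a b \is (deg a - deg' b).-homog) ->
  hpart deg' d (y *m M) = hpart deg d y *m M.
Proof.
move=> hM; apply/rowP=> b; rewrite !mxE linear_sum /=.
have -> : (if (deg' b <= d)%N then
      \sum_a pihomog mdeg (d - deg' b) (y 0 a * M a b) else 0) =
    \sum_a if (deg' b <= d)%N then pihomog mdeg (d - deg' b) (y 0 a * M a b) else 0.
  by case: ifP => // _; rewrite big1.
apply: eq_bigr => a _; rewrite mxE.
have [->|/hM[leba hMab]] := eqVneq (M a b) 0; first by rewrite !mulr0 linear0 if_same.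
rewrite (pihomogM _ _ hMab); have [led|ltd] := leqP (deg' b) d; last first.
  by rewrite leqNgt (leq_trans ltd leba) mul0r.
have -> : (deg a - deg' b <= d - deg' b)%N = (deg a <= d)%N by lia.
have -> : (d - deg' b - (deg a - deg' b) = d - deg a)%N by lia.
by case: ifP; rewrite ?mul0r.
Qed.

(** Entry a is homogeneous of positive degree d - deg a, hence has no constant term. *)
Lemma hpart_in_varsM d y : (forall a, (deg a < d)%N) ->
  hpart deg d y = y -> in_varsM setT y.
Proof.
move=> ltd hy; apply: in_varsM_row => a; apply/in_varsM_msupp => m.
rewrite -hy mxE ltnW // => /(dhomog_mf (pihomogP _ _ _)) Em.
apply: contraT; rewrite negb_exists => /forallP m0.
have := ltd a; rewrite -subn_gt0 -Em /= mdegE big1 // => v _.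
by apply/eqP; move: (m0 v); rewrite inE negbK.
Qed.

End HPart.

Lemma hpart_mulcol r (deg : 'I_r -> nat) (c : 'cV[R]_r) d y :
  (forall a, c a 0 \is (deg a).-homog) ->
  (hpart deg d y *m c) 0 0 = pihomog mdeg d ((y *m c) 0 0).
Proof.
move=> hc; rewrite !mxE linear_sum /=; apply: eq_bigr => a _.
by rewrite mxE (pihomogM _ _ (hc a)); case: ifP; rewrite ?mul0r.
Qed.

End GradedParts.

(** * Zigzag between Koszul cycles and a graded resolution *)

Section KoszulTor.

Variables (n : nat) (K : fieldType) (I : rset n K) (F : min_free_res I).
Local Notation R := {mpoly K[n]}.
Local Notation rk := (mfr_rank F).
Local Notation deg := (@mfr_deg _ _ _ F _).
Local Notation diff := (mfr_diff F).

Variables (U : {set 'I_n}) (q d : nat).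
(* Either F_q = 0, or an element of degree d + q of F_q has no constant
   coefficient, so that it lies in (x_1, ..., x_n) F_q. *)
Hypothesis deg_lt : forall a : 'I_(rk q), (deg a < d + q)%N /\ U = setT.

(** Chains of total homological degree q and internal degree d + q: the part with values in F_k is
    supported on the e_T with q - k indices in U. *)
Let graded_chain k (z : {set 'I_n} -> 'rV[R]_(rk k)) :=
  forall T, hpart deg (d + k) (z T) = z T /\
            (z T != 0 -> (#|T :&: U| + k)%N = q).

Lemma card_setUI (T : {set 'I_n}) u : u \in U :\: T ->
  #|(u |: T) :&: U| = #|T :&: U|.+1.
Proof.
rewrite inE => /andP[uT uU]; rewrite setIUl (setIidPl _) ?sub1set //.
by rewrite cardsU1 inE (negPf uT).
Qed.

(** Induction on l = q - k. The Koszul differential of z lifts to F_(k+1); the induction hypothesis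
    for the lift gives a correction after which z is a Koszul cycle. In the base case z has Koszul
    degree 0 and, by [deg_lt], its components lie in (x_U) F_q, so [koszul_exact] applies. *)
Lemma chain_reduce l k (z : {set 'I_n} -> 'rV[R]_(rk k)) :
    (k + l = q)%N -> graded_chain z ->
    (forall T, exists w, koszul_d U z T = w *m diff k) ->
  exists w w', forall T, z T = koszul_d U w T + w' T *m diff k.
Proof.
elim: l k z => [|l IHl] k z Ekl gz dz.
  rewrite addn0 in Ekl; move: z gz dz; rewrite Ekl => z gz _.
  have z0 T : #|T :&: U| != 0%N -> z T = 0.
    move=> TU; apply: contraNeq TU => zT; have [_ /(_ zT)] := gz T; lia.
  have [T|T dTU|w Ew] := @koszul_exact _ _ U _ z; last first.
  - by exists w, (fun=> 0) => T; rewrite mul0mx addr0.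
  - have [hz _] := gz T.
    case: (posnP (rk q)) => [rq|rq].
      suff -> : z T = 0 by apply: in_varsM0.
      by apply/rowP=> a; have := ltn_ord a; rewrite {2}rq.
    have [_ ->] := deg_lt (Ordinal rq).
    by apply: hpart_in_varsM hz => a; have [] := deg_lt a.
  rewrite /koszul_d big1 // => u uUT; rewrite z0 ?scaler0 //.
  by rewrite card_setUI.
have dz_deg T : hpart deg (d + k).+1 (koszul_d U z T) = koszul_d U z T.
  by apply: hpart_koszul_d => T'; have [] := gz T'.
have dz_supp T : (#|T :&: U| + k.+1 != q)%N -> koszul_d U z T = 0.
  move=> nq; rewrite /koszul_d big1 // => u uUT.
  have [->|/(proj2 (gz _))] := eqVneq (z (u |: T)) 0; first by rewrite scaler0.
  by rewrite card_setUI // addSnnS => Eq; rewrite Eq eqxx in nq.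
have [y Ey] := fin_all_exists dz.
(* The chosen lift is cut down to the right internal and Koszul degrees, so that it is again a
   graded chain. *)
pose z' T := if (#|T :&: U| + k.+1 == q)%N then hpart deg (d + k.+1) (y T) else 0.
have Ez' T : koszul_d U z T = z' T *m diff k.
  rewrite /z'; case: ifPn => [_|/dz_supp ->]; last by rewrite mul0mx.
  by rewrite -(hpart_mulmx _ _ (@mfr_diff_homog _ _ _ F k)) -Ey addnS dz_deg.
have [T|T|w [w' Ew]] := IHl k.+1 z' (etrans (addSnnS k l) Ekl).
- rewrite /z'; split; case: ifP => [/eqP //|_]; rewrite ?hpart_id ?hpart0 //.
  by rewrite eqxx.
- apply/mfr_exactS; rewrite -koszul_d_mulmx.
  rewrite -[RHS](koszul_d_sq U z T); apply: eq_koszul_d => u _.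
  by rewrite Ez'.
(* No differential involves the components on T disjoint from U; clearing them gives the
   Koszul-degree-0 condition of [koszul_exact]. *)
pose w1 T := if T :&: U == set0 then 0 else w T.
have Ew1 T : koszul_d U w1 T = koszul_d U w T.
  apply: eq_koszul_d => u uUT; rewrite /w1 ifF // -cards_eq0 card_setUI //.
have dzw T : koszul_d U (fun T => z T - w1 T *m diff k) T = 0.
  rewrite koszul_dB koszul_d_mulmx Ew1 Ez' Ew mulmxDl.
  have /mfr_exactS -> : exists v, w' T *m diff k.+1 = v *m diff k.+1 by exists (w' T).
  by rewrite addr0 subrr.
have [T dTU|w2 Ew2] := koszul_exact dzw.
  rewrite /w1 ifT ?setI_eq0 // mul0mx subr0.
  suff -> : z T = 0 by apply: in_varsM0.
  apply/eqP/negPn/negP=> zT; have [_ /(_ zT)] := gz T.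
  rewrite (disjoint_setI0 dTU) cards0; lia.
by exists w2, w1 => T; rewrite -Ew2 subrK.
Qed.

(* In Tor terms: H_q(x_U; R/I) vanishes in internal degree d + q. *)
Lemma koszul_cycle_boundary (z : {set 'I_n} -> R^o) :
    is_ideal I -> (forall e f, I f -> I (pihomog mdeg e f)) ->
    (forall T, z T \is d.-homog) ->
    (forall T, z T != 0 -> #|T :&: U| = q) ->
    (forall T, I (koszul_d U z T)) ->
  exists w : {set 'I_n} -> R^o, forall T, I (z T - koszul_d U w T).
Proof.
move=> idI homI hz zq dz; have [I0 ID IM] := idI.
(* z is lifted to F_0 along the augmentation; the component of degree d of the lift still represents
   z modulo I. *)
have [y0 Ey0] := fin_all_exists (fun T => mfr_aug_surj F (z T)).
pose y T := if #|T :&: U| == q then hpart deg d (y0 T) else 0.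
have Ey T : I (z T - (y T *m mfr_aug F) 0 0).
  rewrite /y; case: ifPn => [_|nq].
    rewrite hpart_mulcol; last exact: mfr_aug_homog.
    by rewrite -[z T](pihomog_dE (hz T)) -linearB; apply/homI/Ey0.
  have -> : z T = 0 by apply/eqP; apply: contraNT nq => /zq ->.
  by rewrite mul0mx mxE subr0.
have aug_kd w T : (koszul_d U w T *m mfr_aug F) 0 0 =
    koszul_d U (fun T => (w T *m mfr_aug F) 0 0 : R^o) T.
  rewrite -koszul_d_mulmx /koszul_d summxE.
  by apply: eq_bigr => u _; rewrite mxE.
have I_kd w T : (forall T, I (w T)) -> I (koszul_d U (w : {set 'I_n} -> R^o) T).
  by move=> Iw; apply: (ideal_sum idI) => u _; apply: IM.
have [|T|T|w [w' Ew]] := @chain_reduce q 0 y.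
- by [].
- rewrite !addn0 /y; split; case: ifP => [/eqP //|_]; rewrite ?hpart_id ?hpart0 //.
  by rewrite eqxx.
- apply/mfr_exact0; rewrite aug_kd.
  rewrite -[koszul_d _ _ _](subKr (koszul_d U z T)) -koszul_dB.
  by apply: idealB => //; apply: I_kd.
exists (fun T => (w T *m mfr_aug F) 0 0) => T.
rewrite -aug_kd -[z T](subrK ((y T *m mfr_aug F) 0 0)) -addrA; apply: ID => //.
rewrite Ew mulmxDl !mxE addrAC subrr add0r.
(* What comes from F_1 is augmented into I. *)
by have := proj2 (mfr_exact0 (w' T *m diff 0)); rewrite mxE; apply; exists (w' T).
Qed.

End KoszulTor.

(** * Edge ideals and cover ideals *)

Section MonomialPrimes.

Variables (n : nat) (K : fieldType).
Local Notation R := {mpoly K[n]}.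
Implicit Types (f g h : R) (m : 'X_{1..n}) (S : pred 'X_{1..n}) (C : {set 'I_n}).

Lemma msupp_split S f : exists f0 f1,
  [/\ f = f0 + f1, msupp_in (predC S) f0 & msupp_in S f1].
Proof.
pose part (Q : pred 'X_{1..n}) := \sum_(m <- msupp f | Q m) f@_m *: 'X_[m].
have partE Q m : ~~ Q m -> (part Q)@_m = 0.
  move=> nQm; rewrite raddf_sum big1 //= => m' Qm'; rewrite mcoeffZ mcoeffX.
  by case: eqP Qm' nQm => [-> ->|] //; rewrite mulr0.
exists (part (predC S)), (part S).
split; [|by apply/msupp_inP=> m; apply: partE..].
by rewrite addrC {1}[f]mpolyE (bigID S).
Qed.

(** Drop from f and g their terms in [S]. The product of the remainders stays in the ideal, yet all
    its monomials lie outside [S]; so it is 0, and one remainder is 0 because R is a domain. *)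
Lemma msupp_in_prime S : up_closed S -> ~~ S 0%MM ->
  (forall m m', ~~ S m -> ~~ S m' -> ~~ S (m + m')%MM) ->
  is_prime_ideal (msupp_in (K := K) S).
Proof.
move=> upS nS0 SD; have idS := msupp_in_ideal K upS; have [S0 SA SM] := idS.
split=> // [/msupp_inP/(_ _ nS0)/eqP|f g Sfg].
  by rewrite mcoeff1 eqxx oner_eq0.
have [f0 [f1 [Ef /msupp_inP Nf0 Sf1]]] := msupp_split S f.
have [g0 [g1 [Eg /msupp_inP Ng0 Sg1]]] := msupp_split S g.
have Sfg0 : msupp_in S (f0 * g0).
  have -> : f0 * g0 = f * g - (g0 * f1 + f * g1) by rewrite Ef Eg; ring.
  by apply: (idealB idS Sfg); apply: SA; apply: SM.
have : f0 * g0 = 0.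
  apply/mpolyP=> m; rewrite mcoeff0; case: (boolP (S m)) => [Sm|]; last first.
    by move: m; apply/msupp_inP.
  apply: memN_msupp_eq0; apply/negP=> /msuppM_le /allpairsP[[m1 m2] /= [m1f m2g Em]].
  move: m1f m2g; rewrite !mcoeff_msupp => m1f m2g.
  have /negP[] : ~~ S m by rewrite Em; apply: SD;
    [move: m1f | move: m2g]; apply: contraNN => Sm'; rewrite ?Nf0 ?Ng0 //= Sm'.
  by [].
move/eqP; rewrite mulf_eq0 => /orP[]/eqP E0; [left | right].
  by rewrite Ef E0 add0r.
by rewrite Eg E0 add0r.
Qed.

Definition mset (C : {set 'I_n}) : 'X_{1..n} := [multinom (v \in C : nat) | v < n].

Lemma msetE C v : mset C v = (v \in C).
Proof. exact: mnmE. Qed.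

Lemma msetU1 v C : v \notin C -> mset (v |: C) = (mset C + U_(v))%MM.
Proof.
move=> vC; apply/mnmP=> w; rewrite mnmDE mnm1E !msetE !inE (eq_sym v).
by case: eqP => [->|]; rewrite ?(negPf vC) //= addn0.
Qed.

Lemma mdeg_mset C : mdeg (mset C) = #|C|.
Proof.
rewrite mdegE -sum1_card [RHS]big_mkcond; apply: eq_bigr => v _.
by rewrite msetE; case: (v \in C).
Qed.

Lemma mpolyX_set C : \prod_(v in C) 'X_v = 'X_[mset C] :> R.
Proof.
rewrite mprodXE; congr 'X_[_]; apply/mnmP=> w; rewrite mnm_sumE msetE.
rewrite big_mkcond (bigD1 w) //= mnm1E eqxx big1 ?addn0 => [|v vw].
  by case: (w \in C).
by rewrite mnm1E (negPf vw) if_same.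
Qed.

Lemma mcoeffMX_eq0 f v m : m v = 0%N -> ('X_v * f)@_m = 0.
Proof.
move=> mv; apply: memN_msupp_eq0; rewrite mulrC (perm_mem (msuppMX _ _)).
by apply/mapP=> [[m' _ Em]]; move: mv; rewrite Em mnmDE mnm1E eqxx.
Qed.

Lemma mcoeffXM_U f v m : ('X_v * f)@_(m + U_(v)) = f@_m.
Proof. by rewrite mulrC addmC mcoeffMX. Qed.

Lemma mcoeff_signM k f m : ((-1) ^+ k * f)@_m = (-1) ^+ k * f@_m.
Proof. by rewrite -signr_odd -[in RHS]signr_odd; case: odd; rewrite ?mulN1r ?mcoeffN ?mul1r. Qed.

End MonomialPrimes.

(** * Monomials of I(G) and J(G) *)

Section GraphIdeals.

Variables (n : nat) (K : fieldType) (e : rel 'I_n).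
Local Notation R := {mpoly K[n]}.
Implicit Types (m : 'X_{1..n}) (C : {set 'I_n}) (i j v : 'I_n).

Definition has_edge (m : 'X_{1..n}) : bool :=
  [exists i, exists j, [&& e i j, m i != 0%N & m j != 0%N]].

Definition covers (m : 'X_{1..n}) : bool :=
  [forall i, forall j, e i j ==> (m i != 0%N) || (m j != 0%N)].

Lemma has_edgeP m : reflect (exists i j, [/\ e i j, m i != 0%N & m j != 0%N]) (has_edge m).
Proof.
apply: (iffP existsP) => [[i /existsP[j /and3P[]]]|[i [j [eij mi mj]]]].
  by exists i, j.
by exists i; apply/existsP; exists j; apply/and3P.
Qed.

Lemma coversP m : reflect (forall i j, e i j -> (m i != 0%N) || (m j != 0%N)) (covers m).
Proof.
apply: (iffP forallP) => [cm i j eij|cm i].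
  by have /forallP/(_ j) := cm i; rewrite eij.
by apply/forallP=> j; apply/implyP/cm.
Qed.

Lemma addm_neq0 (m m' : 'X_{1..n}) i : m i != 0%N -> (m + m')%MM i != 0%N.
Proof. by rewrite mnmDE addn_eq0 negb_and => ->. Qed.

Lemma has_edge_up : up_closed has_edge.
Proof.
move=> m m' /has_edgeP[i [j [eij mi mj]]]; apply/has_edgeP.
by exists i, j; rewrite !addm_neq0.
Qed.

Lemma covers_up : up_closed covers.
Proof.
move=> m m' /coversP cm; apply/coversP=> i j /cm /orP[] mi.
  by rewrite addm_neq0.
by rewrite orbC addm_neq0.
Qed.

Lemma edge_idealE : irreflexive e ->
  same_rset (edge_ideal K e) (msupp_in has_edge).
Proof.
move=> e_irr; apply: ideal_gen_msupp has_edge_up _ _ => [_ [i [j [eij ->]]]|m].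
  exists (U_(i) + U_(j))%MM; first by rewrite mpolyXD.
  apply/has_edgeP; exists i, j.
  by split; rewrite // mnmDE !mnm1E eqxx ?addn1.
case/has_edgeP=> i [j [eij mi mj]]; exists (U_(i) + U_(j))%MM, (m - (U_(i) + U_(j)))%MM.
split; first by exists i, j; rewrite mpolyXD.
rewrite addmC submK //; apply/mnm_lepP=> v; rewrite mnmDE !mnm1E.
(* A loop at i would require exponent 2 there; for distinct ends, exponent 1 at each suffices. *)
have ij : i != j by apply: contraTneq eij => ->; rewrite e_irr.
case: (eqVneq i v) mi => [<- mi|_ _]; first by rewrite eq_sym (negPf ij) lt0n.
by case: (eqVneq j v) mj => // <-; rewrite lt0n.
Qed.

Lemma cover_idealE : same_rset (cover_ideal K e) (msupp_in covers).
Proof.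
have coversE C : vertex_cover e C = covers (mset C).
  apply: eq_forallb => i; apply: eq_forallb => j; rewrite !msetE.
  by case: (i \in C); case: (j \in C).
apply: ideal_gen_msupp covers_up _ _ => [_ [C [/minsetp Cmin ->]]|m cm].
  by exists (mset C); [rewrite mpolyX_set | rewrite -coversE].
have : vertex_cover e [set v | m v != 0%N].
  apply/forallP=> i; apply/forallP=> j; apply/implyP; rewrite !inE.
  by move/coversP: cm; apply.
(* A minimal cover inside the support of m gives a generator dividing the monomial. *)
case/minset_exists=> C Cmin /subsetP sCm; exists (mset C), (m - mset C)%MM.
split; first by exists C; rewrite mpolyX_set.
rewrite addmC submK //; apply/mnm_lepP=> v; rewrite msetE.
by case: (boolP (v \in C)) => // /sCm; rewrite inE lt0n.
Qed.

End GraphIdeals.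

(** * Independent sets with a disconnected link *)

Section FarSets.

Variables (n : nat) (K : fieldType) (e : rel 'I_n).
Hypotheses (e_sym : ssrbool.symmetric e) (e_irr : irreflexive e).
Local Notation R := {mpoly K[n]}.
Implicit Types (A : {set 'I_n}) (v w : 'I_n) (m : 'X_{1..n}).

(* V \ N[A] *)
Definition far A : {set 'I_n} := [set v in ~: A | [forall a in A, ~~ e v a]].

Definition independent A := [forall a in A, forall b in A, ~~ e a b].

(** Maximality is recorded only through [mfe_trans], by which the parts of [far A] are the classes
    of non-adjacency; p1 and p2 lie in different parts. *)
Record max_far_edge A p1 p2 : Prop := MaxFarEdge {
  mfe_indep : independent A;
  mfe_far1 : p1 \in far A;
  mfe_far2 : p2 \in far A;
  mfe_edge : e p1 p2;
  mfe_trans : {in far A & &, forall w a b, ~~ e w a -> ~~ e w b -> ~~ e a b}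
}.

Lemma farP A v : reflect (v \notin A /\ {in A, forall a, ~~ e v a}) (v \in far A).
Proof. by rewrite !inE; apply: (iffP andP) => -[vA /forall_inP]. Qed.

Lemma independentP A : reflect {in A &, forall a b, ~~ e a b} (independent A).
Proof.
apply: (iffP forall_inP) => [iA a b aA|iA a aA].
  by move: b; apply/forall_inP/iA.
by apply/forall_inP=> b; apply: iA.
Qed.

Lemma independentU1 A v : independent A -> v \in far A -> independent (v |: A).
Proof.
move=> /independentP iA /farP[vA ev]; apply/independentP => a b.
rewrite !in_setU1 => /predU1P[->|aA] /predU1P[->|bA]; rewrite ?e_irr ?ev //.
  by rewrite e_sym ev.
exact: iA.
Qed.

(** Take A of maximal size, starting from the empty set. If transitivity failed at w, a, b, then w
    could be added to A, with the edge ab still far from it. *)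
Lemma max_far_edge_exists : (exists i j, e i j) ->
  exists A p1 p2, max_far_edge A p1 p2.
Proof.
pose P A := independent A && [exists i in far A, exists j in far A, e i j].
case=> i0 [j0 e0].
have P0 : P set0.
  apply/andP; split; first by apply/independentP=> a b; rewrite inE.
  apply/exists_inP; exists i0; first by apply/farP; split=> [|a]; rewrite inE.
  apply/exists_inP; exists j0 => //.
  by apply/farP; split=> [|a]; rewrite inE.
case: (@arg_maxnP _ set0 P (fun A => #|A|) P0) => A.
case/andP=> iA /exists_inP[p1 p1A /exists_inP[p2 p2A e12]] maxA.
exists A, p1, p2; split=> // w a b wA aA bA ewa ewb; apply/negP=> eab.
have aw : a != w by apply: contraTneq eab => ->.
have bw : b != w by apply: contraTneq eab => ->; rewrite e_sym.
have farU v : v \in far A -> v != w -> ~~ e w v -> v \in far (w |: A).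
  move=> /farP[vA ev] vw ewv; apply/farP; split.
    by rewrite in_setU1 negb_or vw.
  by move=> c /setU1P[->|/ev //]; rewrite e_sym.
have PU : P (w |: A).
  rewrite /P independentU1 //; apply/exists_inP; exists a; first exact: farU.
  by apply/exists_inP; exists b; first exact: farU.
have := maxA _ PU; rewrite cardsU1; case/farP: wA => -> _.
by move=> /=; rewrite add1n ltnn.
Qed.

Section MaxFarEdge.

Variables (A : {set 'I_n}) (p1 p2 : 'I_n).
Hypothesis mfe : max_far_edge A p1 p2.

Let iA : independent A. Proof. by case: mfe. Qed.
Let p1A : p1 \in far A. Proof. by case: mfe. Qed.
Let p2A : p2 \in far A. Proof. by case: mfe. Qed.
Let e12 : e p1 p2. Proof. by case: mfe. Qed.
Let trA := mfe_trans mfe.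
Let p1p2 : p1 != p2. Proof. by apply: contraTneq e12 => ->; rewrite e_irr. Qed.

(** * The bound on the v-number *)

Local Notation D := (~: A :\: [set p1; p2]).

Lemma far_notin v : v \in far A -> v \notin A.
Proof. by case/farP. Qed.

Lemma cardsD_far : (#|D| + 2 = #|~: A|)%N.
Proof.
rewrite -(cardsID [set p1; p2] (~: A)) addnC (setIidPr _) ?cards2 ?p1p2 //.
by apply/subsetP=> v; rewrite !inE => /orP[]/eqP->; apply: far_notin.
Qed.

(** D misses only A, p1 and p2, and p1 p2 is the only edge among these vertices. *)
Lemma covers_setD (m : 'X_{1..n}) :
  covers e (mset D + m)%MM = (m p1 != 0%N) || (m p2 != 0%N).
Proof.
apply/coversP/idP => [/(_ _ _ e12)|m12 i j eij].
  by rewrite !mnmDE !msetE !inE !eqxx orbT.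
rewrite !mnmDE !msetE !addn_eq0 !negb_and.
have inD v : ((v \in D : nat) != 0%N) = (v \in D) by case: (v \in D).
rewrite !inD; apply: contraLR eij; rewrite !negb_or => /andP[/andP[iD mi] /andP[jD mj]].
have far_or v : v \notin D -> ~~ (m v != 0%N) ->
    [\/ v \in A, v = p1 /\ m p1 = 0%N | v = p2 /\ m p2 = 0%N].
  rewrite !inE negb_and !negbK => /orP[/orP[]/eqP->|->] /eqP mv.
  - by constructor 2.
  - by constructor 3.
  - by constructor 1.
have [_ ev1] := farP _ _ p1A; have [_ ev2] := farP _ _ p2A.
have /independentP iA' := iA.
case: (far_or i iD mi) => [iiA|[-> m1]|[-> m2]];
  case: (far_or j jD mj) => [jA|[-> m1']|[-> m2']];
  rewrite ?e_irr ?ev1 ?ev2 // ?[e i _]e_sym ?ev1 ?ev2 //.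
- by rewrite iA'.
- by move: m12; rewrite m1 m2'.
- by move: m12; rewrite m1' m2.
Qed.

Lemma colon_cover_ideal :
  same_rset (colon (cover_ideal K e) 'X_[mset D])
    (msupp_in (fun m => (m p1 != 0%N) || (m p2 != 0%N))).
Proof.
move=> f; split=> [/cover_idealE Sf m|Sf]; last apply/cover_idealE => m.
  rewrite -covers_setD => mf; apply: Sf.
  by rewrite (perm_mem (msuppMX _ _)); apply/mapP; exists m.
by rewrite (perm_mem (msuppMX _ _)) => /mapP[m' /Sf Sm' ->]; rewrite covers_setD.
Qed.

(** The support condition describes the prime (x_p1, x_p2); X_D serves both as f and as the witness
    that this prime is associated. *)
Lemma v_degree_cover_ideal : v_degree (cover_ideal K e) #|D|.
Proof.
exists 'X_[mset D], (msupp_in (fun m => (m p1 != 0%N) || (m p2 != 0%N))).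
split; [by rewrite dhomogX /= mdeg_mset | split | exact: colon_cover_ideal].
  apply: msupp_in_prime => [m m' /orP[]m12||m m'].
  - by rewrite (addm_neq0 _ m12).
  - by rewrite (addm_neq0 _ m12) orbT.
  - by rewrite !mnm0E.
  rewrite !mnmDE !addn_eq0 !negb_or !negbK.
  by move=> /andP[-> ->] /andP[-> ->].
by exists 'X_[mset D]; apply: colon_cover_ideal.
Qed.

(** * The bound on the projective dimension of R/I(G) *)

Lemma has_edge_far p : p \in far A -> ~~ has_edge e (mset A + U_(p))%MM.
Proof.
move=> pA; rewrite -msetU1 ?far_notin //; apply/negP=> /has_edgeP[i [j []]].
rewrite !msetE => eij; case: (boolP (i \in _)) => // iU; case: (boolP (j \in _)) => // jU _ _.
by move: eij; apply/negP; move/independentP: (independentU1 iA pA); apply.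
Qed.

(** If the module were zero, the Koszul cycle z would be a boundary modulo I; the coefficients of
    X_A x_p, for p in different parts, exclude this. *)
Lemma rank_edge_ideal_gt0 (F : min_free_res (edge_ideal K e)) :
  (0 < mfr_rank F #|~: A|.-1)%N.
Proof.
rewrite lt0n; apply/negP=> /eqP F0.
(* P is the part of p1, [delta] is e_U with U = [~: A], and z is X_A d_P(e_U). *)
pose P := [set w in far A | ~~ e w p1].
pose delta : {set 'I_n} -> R^o := fun T => (T == ~: A)%:R.
pose z : {set 'I_n} -> R^o := fun T => 'X_[mset A] *: koszul_d P delta T.
have farA v : v \in far A -> v \in ~: A by rewrite !inE => /andP[].
have sPA : P \subset ~: A by apply/subsetP=> v; rewrite inE => /andP[/farA].
have p1P : p1 \in P by rewrite inE p1A e_irr.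
have p2P : p2 \notin P by rewrite inE p2A e_sym e12.
(* If u is far from A, it lies in another part than w and is adjacent to it; otherwise u is adjacent
   to a vertex of A. *)
have edgePD u w : u \in ~: A :\: P -> w \in P -> has_edge e (U_(u) + (mset A + U_(w)))%MM.
  rewrite in_setD => /andP[uP uA] wP; move: (wP); rewrite inE => /andP[wA ewp].
  apply/has_edgeP; case: (boolP (u \in far A)) => [ufar|].
    exists u, w; rewrite !mnmDE !mnm1E !eqxx !addnS; split=> //.
    rewrite inE ufar /= negbK in uP; apply: contraTT uP => euw.
    by apply: (trA wA) => //; rewrite e_sym.
  rewrite inE uA negb_forall => /existsP[a]; rewrite negb_imply negbK => /andP[aA eua].
  exists u, a; rewrite !mnmDE !mnm1E !msetE eqxx aA; split=> //.
  by rewrite !(addnS, addSn).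
have kd_delta U' p : p \in ~: A -> koszul_d U' delta (~: A :\ p) =
    if p \in U' then ksign K p (~: A :\ p) * 'X_p else 0.
  move=> pA; rewrite /koszul_d; have del v : v \in U' :\: (~: A :\ p) -> v != p ->
      delta (v |: (~: A :\ p)) = 0.
    rewrite /delta => _ vp; case: eqP => // /setP/(_ p).
    by rewrite pA !inE eqxx (eq_sym p) (negPf vp).
  case: ifPn => pU; last first.
    rewrite big1 // => v vU; rewrite del ?scaler0 //.
    by apply: contraTneq vU => ->; rewrite inE (negPf pU) andbF.
  rewrite (bigD1 p) /=; last by rewrite !inE eqxx pU.
  rewrite big1 ?addr0 => [|v /andP[vU vp]]; last by rewrite del ?scaler0.
  by rewrite setD1K // /delta eqxx; apply: mulr1.
have hz T : z T \is #|A|.+1.-homog.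
  rewrite -addn1 -(mdeg_mset A); apply: dhomogM; first by rewrite dhomogX.
  apply: rpred_sum => u _; rewrite -[_ *: _]/(_ * _) /delta /ksign.
  rewrite -signr_odd; case: odd; case: eqP => _; rewrite ?mulr0 ?rpred0 //.
    by rewrite mulr1 mulN1r rpredN dhomogX /= mdeg1.
  by rewrite mulr1 mul1r dhomogX /= mdeg1.
have zq T : z T != 0 -> #|T :&: ~: A| = #|~: A|.-1.
  apply: contraNeq => nT; rewrite /z /koszul_d big1 ?scaler0 // => u.
  rewrite !inE => /andP[uT uP]; rewrite /delta; case: eqP => [ET|_]; last exact: scaler0.
  case/eqP: nT; rewrite -ET cardsU1 uT (setIidPl _) //.
  by apply/subsetP=> v vT; rewrite inE vT orbT.
have idI : is_ideal (msupp_in (K := K) (has_edge e)) by apply/msupp_in_ideal/has_edge_up.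
have [_ _ IM] := idI.
have dz T : msupp_in (has_edge e) (koszul_d (~: A) z T).
  (* The differential over P kills z; the one over the rest of U produces multiples of x_u x_w X_A,
     which lie in I by [edgePD]. *)
  rewrite (koszul_d_setD _ _ sPA) /z !koszul_dZ koszul_d_sq scaler0 add0r.
  rewrite /koszul_d scaler_sumr; apply: (ideal_sum idI) => u.
  rewrite in_setD => /andP[uT uD]; rewrite !scaler_sumr; apply: (ideal_sum idI) => w.
  rewrite in_setD => /andP[wT wP]; have := edgePD u w uD wP.
  move/(@msupp_inX _ K); rewrite !mpolyXD => Iuw.
  rewrite -![_ *: _]/(_ * _).
  set d := delta _; set s1 := ksign _ _ _; set s2 := ksign _ _ _.
  have -> : 'X_[mset A] * (s1 * 'X_u * (s2 * 'X_w * d)) =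
    (s1 * s2 * d) * ('X_u * ('X_[mset A] * 'X_w)) :> R by ring.
  exact: IM.
have edgeI f : edge_ideal K e f <-> msupp_in (has_edge e) f by apply: edge_idealE.
have [a|||T|w Ew] := @koszul_cycle_boundary _ _ _ F (~: A) #|~: A|.-1 #|A|.+1 _ z _ _ hz zq.
- by have := ltn_ord a; rewrite {2}F0.
- exact: is_ideal_same edgeI idI.
- by move=> c f /edgeI If; apply/edgeI/msupp_in_pihomog.
- exact/edgeI.
(* Along e_(U - p), only the component of w at e_U contributes to dw. *)
have z_p p : p \in ~: A -> z (~: A :\ p) - koszul_d (~: A) w (~: A :\ p) =
    ksign K p (~: A :\ p) * ('X_p * ('X_[mset A] *+ (p \in P) - w (~: A))) :> R.
  move=> pA; rewrite /z kd_delta //; have -> : koszul_d (~: A) w (~: A :\ p) =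
      (ksign K p (~: A :\ p) * 'X_p) * w (~: A) :> R.
    rewrite /koszul_d (big_pred1 p) ?setD1K // => v; rewrite !inE negb_and negbK.
    by case: eqP => [->|_] /=; [rewrite -in_setC pA | case: (v \in A)].
  by rewrite -[_ *: _]/(_ * _ : R); case: (p \in P); rewrite ?mulr1n ?mulr0n ?mulr0; ring.
(* X_A x_p is not in I, so its coefficient must vanish. This forces the same coefficient of w at e_U
   to be 1 for p1 and 0 for p2. *)
have w_coef p : p \in far A -> (w (~: A))@_(mset A) = (p \in P)%:R.
  move=> pA; have /edgeI/msupp_inP/(_ _ (has_edge_far pA)) := Ew (~: A :\ p).
  rewrite z_p ?farA // mcoeff_signM mcoeffXM_U mcoeffB mcoeffMn mcoeffX eqxx.
  move/eqP; rewrite mulf_eq0 signr_eq0 /= subr_eq0 => /eqP <-.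
  by case: (p \in P).
have := w_coef p2 p2A; rewrite (w_coef p1 p1A) p1P (negPf p2P) => /eqP.
by rewrite oner_eq0.
Qed.

(** * The bound on the regularity of R/J(G) *)

Lemma mcoeff_koszul_d_setT (w : {set 'I_n} -> R^o) (U T : {set 'I_n}) :
  (koszul_d setT w T : R)@_(mset (U :\: T)) =
  \sum_(c in U :\: T) (-1) ^+ #|[set t in T | (t < c)%N]| *
    (w (c |: T))@_(mset (U :\: (c |: T))).
Proof.
rewrite raddf_sum /= big_mkcond [RHS]big_mkcond; apply: eq_bigr => c _.
rewrite !in_setD inE andbT; case: (boolP (c \in T)) => //= cT.
rewrite -[_ *: _]/(_ * _ : R) -mulrA mcoeff_signM.
(* For c outside U, x_c does not divide X_(U - T), so only indices in U contribute in multidegree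
   U. *)
case: ifPn => cU; last by rewrite mcoeffMX_eq0 ?mulr0 // msetE !inE (negPf cU) andbF.
have -> : mset (U :\: T) = (mset (U :\: (c |: T)) + U_(c))%MM.
  rewrite -msetU1 ?inE ?eqxx //; congr mset; apply/setP=> v; rewrite !inE.
  by case: eqP => [->|]; rewrite ?cT ?cU.
by rewrite mcoeffXM_U.
Qed.

(** The complement of a cover is independent, so a and b are far from A and non-adjacent to each
    other: they belong to the same part. *)
Lemma covers_set2D a b : a \in ~: A -> b \in ~: A ->
  covers e (mset (~: A :\: [set a; b])) -> e a p1 = e b p1.
Proof.
move=> aU bU /coversP cov.
have ncov v w : v \in A :|: [set a; b] -> w \in A :|: [set a; b] -> ~~ e v w.
  have out x : x \in A :|: [set a; b] -> (x \in ~: A :\: [set a; b]) = false.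
    by rewrite in_setU in_setD in_setC => /orP[]->; rewrite ?andbF.
  by move=> vab wab; apply/negP=> /cov; rewrite !msetE !out.
have aab : a \in A :|: [set a; b] by rewrite !inE eqxx orbT.
have bab : b \in A :|: [set a; b] by rewrite !inE eqxx !orbT.
have farab v : v \in ~: A -> v \in A :|: [set a; b] -> v \in far A.
  rewrite inE => vA vab; apply/farP; split=> // x xA.
  by apply: ncov => //; rewrite inE xA.
have [aF bF] : a \in far A /\ b \in far A by split; apply: farab.
apply/idP/idP; apply: contraTT.
  exact: (trA bF aF p1A (ncov _ _ bab aab)).
exact: (trA aF bF p1A (ncov _ _ aab bab)).
Qed.

(** Otherwise the cycle X_D e_p1 e_p2 would be a boundary modulo J, whereas the functional given by
    summing [G] kills boundaries and J-valued chains and is a sign on this cycle. *)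
Lemma generator_cover_ideal (F : min_free_res (cover_ideal K e)) :
  exists a : 'I_(mfr_rank F 2), (#|~: A| <= mfr_deg a)%N.
Proof.
case: (boolP [exists a : 'I_(mfr_rank F 2), (#|~: A| <= mfr_deg a)%N]).
  by move/existsP.
rewrite negb_exists => /forallP deg_lt; exfalso.
pose U := ~: A.
pose z : {set 'I_n} -> R^o := fun T => if T == [set p1; p2] then 'X_[mset D] else 0.
(* On [far A] this is the indicator of the part of p1: it is 1 at p1 and 0 at p2. *)
pose chi a : K := (~~ e a p1)%:R.
pose s (a b : 'I_n) : K := (-1) ^+ (a < b)%N.
have sN a b : a != b -> s b a = - s a b.
  rewrite /s => ab; case: (ltngtP a b) => [_|_|/val_inj E]; rewrite ?opprK //.
  by rewrite E eqxx in ab.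
(* G is the coboundary of chi, a functional on the part of multidegree U of the
   complex Koszul (x) R/J: it is well defined since chi is constant on the
   parts, and it vanishes on boundaries. *)
pose G (y : {set 'I_n} -> R^o) a b := if [&& a \in U, b \in U & a != b] then
  chi a * s a b * (y [set a; b])@_(mset (U :\: [set a; b])) else 0.
have G_cover y : (forall T, cover_ideal K e (y T)) -> \sum_a \sum_b G y a b = 0.
  move=> Jy; apply: sum_antisym => [a b|a]; last by rewrite /G eqxx !andbF.
  rewrite /G (eq_sym b) andbCA; case: ifP => [/and3P[bU aU ab]|_]; last by rewrite oppr0.
  rewrite [in RHS]setUC [s b a]sN //; set T := [set a; b].
  (* If X_(U - T) is in J, then chi a = chi b and exchanging a and b flips the sign; otherwise the
     coefficient vanishes. *)
  case: (boolP (covers e (mset (U :\: T)))) => [cov|ncov].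
    by rewrite /chi (covers_set2D aU bU cov) mulrN mulNr opprK.
  have /cover_idealE/msupp_inP/(_ _ ncov) -> := Jy T.
  by rewrite !mulr0 oppr0.
have G_kd (w : {set 'I_n} -> R^o) : \sum_a \sum_b G (koszul_d setT w) a b = 0.
  apply: big1 => a _.
  (* Already for fixed a the sum over b and c cancels: exchanging them only flips [s b c]. *)
  pose H b c := if [&& a \in U, b \in U, c \in U, a != b, a != c & b != c] then
    chi a * (s a b * s a c) * s b c *
      (w (c |: [set a; b]))@_(mset (U :\: (c |: [set a; b]))) else 0.
  rewrite -[RHS](@sum_antisym _ _ H) => [|b c|b]; last by rewrite /H eqxx !andbF.
    apply: eq_bigr => b _; rewrite /G /H; case: (a \in U); last by rewrite big1.
    case: (b \in U); last by rewrite big1.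
    case: (boolP (a == b)) => [_|ab] /=; first by rewrite big1 // => c _; rewrite andbF.
    rewrite mcoeff_koszul_d_setT mulr_sumr big_mkcond; apply: eq_bigr => c _.
    rewrite in_setD in_set2 negb_or (eq_sym c a) (eq_sym c b) andbC.
    case: ifP => // _.
    have -> : #|[set t in [set a; b] | (t < c)%N]| = ((a < c) + (b < c))%N.
      rewrite -sum1dep_card big_mkcondr big_setU1 ?inE //= big_set1.
      by case: (a < c)%N; case: (b < c)%N.
    by rewrite exprD /s; ring.
  rewrite /H; have -> : [&& a \in U, c \in U, b \in U, a != c, a != b & c != b] =
      [&& a \in U, b \in U, c \in U, a != b, a != c & b != c].
    by rewrite (eq_sym c b) [in LHS]andbCA; do 4!bool_congr.
  case: ifP => [/and5P[_ _ _ _ /andP[_ bc]]|_]; last by rewrite oppr0.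
  have -> : b |: [set a; c] = c |: [set a; b] by apply/setP=> v; rewrite !inE; do !case: eqP.
  by rewrite (sN b c) //; ring.
have G_z : \sum_a \sum_b G z a b = s p1 p2.
  (* z is supported on {p1, p2}, and chi p2 = 0 discards the order (p2, p1). *)
  have Gab a b : (a == p1) && (b == p2) = false -> G z a b = 0.
    move=> nab; rewrite /G /z; case: ifP => // /and3P[_ _ ab].
    case: eqP => [/setP E|_]; last by rewrite mcoeff0 mulr0.
    suff -> : chi a = 0 by rewrite !mul0r.
    have := E a; have := E b; rewrite !inE !eqxx orbT /=.
    case/esym/orP=> /eqP Eb /esym/orP[]/eqP Ea; rewrite Ea Eb ?eqxx // in ab nab *.
    by rewrite /chi e_sym e12.
  rewrite (bigD1 p1) //= (bigD1 p2) //= !big1 ?addr0 => [|a ap1|b bp2].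
  - rewrite /G !inE !far_notin // p1p2 /z eqxx mcoeffX eqxx /chi e_irr.
    by rewrite mul1r mulr1.
  - by apply: big1 => b _; rewrite Gab // (negPf ap1).
  - by rewrite Gab // (negPf bp2) andbF.
have idJ : is_ideal (cover_ideal K e).
  by apply: is_ideal_same (@cover_idealE _ K e) _; apply/msupp_in_ideal/covers_up.
(* With q = 2 and d = |D|, d + q = |U|, so the assumed degree bound on F_2 is the required one. *)
have [a|||T|T|w Ew] := @koszul_cycle_boundary _ _ _ F setT 2 #|D| _ z idJ.
- by rewrite cardsD_far // ltnNge; split=> //; apply: deg_lt.
- by move=> d f /cover_idealE Jf; apply/cover_idealE/msupp_in_pihomog.
- by move=> T; rewrite /z; case: ifP; rewrite ?rpred0 // dhomogX /= mdeg_mset.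
- rewrite /z; case: (T =P _) => [->|_]; last by rewrite eqxx.
  by rewrite setIT cards2 p1p2.
- have [_ _ JM] := idJ.
  (* A nonzero term is, up to sign, X_D times x_p1 or x_p2, which lies in J. *)
  apply: (ideal_sum idJ) => u _; rewrite /z; case: eqP => [E|_]; last first.
    by rewrite scaler0; case: idJ.
  rewrite -[_ *: _]/(_ * _ : R) -mulrA -mpolyXD; apply: JM.
  apply/cover_idealE/msupp_inX; rewrite addmC covers_setD !mnm1E.
  by have := setU11 u T; rewrite E !inE => /orP[]/eqP->; rewrite eqxx ?orbT.
have := G_cover _ Ew.
have -> : \sum_a \sum_b G (fun T => z T - koszul_d setT w T) a b =
    \sum_a \sum_b G z a b - \sum_a \sum_b G (koszul_d setT w) a b.
  rewrite -sumrB; apply: eq_bigr => a _; rewrite -sumrB; apply: eq_bigr => b _.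
  by rewrite /G; case: ifP => _; rewrite ?subrr // mcoeffB mulrBr.
by rewrite G_z G_kd subr0 => /eqP; rewrite signr_eq0.
Qed.

End MaxFarEdge.

End FarSets.

(** * Existence of the v-number and conclusion *)

Lemma vnumber_exists (n : nat) (K : fieldType) (I : rset n K) d :
  v_degree I d -> exists v, is_vnumber I v.
Proof.
elim/ltn_ind: d => d IHd Id.
(* [v_degree] is not decidable, so the least degree is found by excluded middle. *)
case: (classic (exists2 d', (d' < d)%N & v_degree I d')) => [[d' /IHd]|min_d].
  exact.
exists d; split=> // d' Id'; rewrite leqNgt; apply/negP=> ltd.
by apply: min_d; exists d'.
Qed.

Lemma graded_betti_neq0 (n : nat) (K : fieldType) (I : rset n K)
    (F : min_free_res I) i (a : 'I_(mfr_rank F i)) :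
  graded_betti F i (mfr_deg a) <> 0%N.
Proof. by apply/eqP; rewrite -lt0n card_gt0; apply/set0Pn; exists a; rewrite inE. Qed.

Theorem theorem3p8 (K : fieldType) (n : nat) (e : rel 'I_n)
    (e_sym : ssrbool.symmetric e) (e_irr : irreflexive e)
    (e_edge : exists i j, e i j) :
  exists v : nat,
    [/\ is_vnumber (cover_ideal K e) v,
        forall r : int, is_reg (cover_ideal K e) r -> v%:Z <= r
      & forall p : nat, is_pd (edge_ideal K e) p -> v%:Z <= p%:Z - 1].
Proof.
have [A [p1 [p2 mfe]]] := max_far_edge_exists e_sym e_irr e_edge.
have vD := v_degree_cover_ideal K e_sym e_irr mfe.
have cardD := cardsD_far e_irr mfe.
have [v vJ] := vnumber_exists vD; exists v.
have lev := proj2 vJ _ vD; split=> // [r|p] [F [_ F_max]].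
  (* A generator of F_2 of degree at least |U| gives r >= |U| - 2 = |D| >= v. *)
  have [a leUa] := generator_cover_ideal e_sym e_irr mfe F.
  by have := F_max _ _ (graded_betti_neq0 (a := a)); lia.
(* A generator of F_(|U|-1) gives p >= |U| - 1 = |D| + 1; [cardD] shows |U| >= 2, so the predecessor
   is not truncated. *)
have a := Ordinal (rank_edge_ideal_gt0 e_sym e_irr mfe F).
by have := F_max _ _ (graded_betti_neq0 (a := a)); lia.
Qed.
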